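(* Let $\Gamma=\langle A,T\rangle\subset\mathrm{Sp}(4,\mathbb{Z})$ be the global monodromy group of the quintic-mirror family, where $$A=\begin{pmatrix}11&8&-5&0\\5&-4&-3&1\\20&15&-9&0\\5&-5&-3&1\end{pmatrix},\qquad T=\begin{pmatrix}1&0&0&0\\0&1&0&-1\\0&0&1&0\\0&0&0&1\end{pmatrix}.$$ Let $$P=\begin{pmatrix}5&-3&0&0\\0&0&1&0\\10&-5&0&0\\0&0&0&1\end{pmatrix}\in\mathrm{GL}(4,\mathbb{Q}),\qquad \Gamma'=\{P^{-1}XP\in\mathrm{GL}(4,\mathbb{Z})\mid X\in\Gamma\},$$ let $\rho:\mathrm{GL}(4,\mathbb{Z})\to\mathrm{GL}(4,\mathbb{Z}/5\mathbb{Z})$ be the natural projection (reduction modulo $5$), and let $\tilde\Gamma=\rho(\Gamma')$. Let $$\hat\Gamma=\left\{\begin{pmatrix}1&n&3n^2+2n&a\\0&1&n&b\\0&0&1&c\\0&0&0&1\end{pmatrix}\in\mathrm{GL}(4,\mathbb{Z}/5\mathbb{Z})\ \middle|\ n,a,b,c\in\mathbb{Z}/5\mathbb{Z}\right\}.$$ Then $\tilde\Gamma=\hat\Gamma$.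
   Context: The quintic-mirror family is the one-parameter family $(W_\lambda)_{\lambda\in\mathbb{P}^1}$ obtained from the quintics $x_1^5+\cdots+x_5^5-5\psi x_1\cdots x_5=0$ in $\mathbb{P}^4$ by quotienting by the group $G\cong(\mathbb{Z}/5\mathbb{Z})^3$ of diagonal symmetries (tuples of 5th roots of unity with product 1, modulo scalars), taking a simultaneous minimal desingularization, and passing to $\lambda=\psi^5$; it is smooth over $\mathbb{P}^1-\{0,1,\infty\}$. For a fixed $b\in\mathbb{P}^1-\{0,1,\infty\}$, its global monodromy group is the image of $\pi_1(\mathbb{P}^1-\{0,1,\infty\},b)$ in $\mathrm{Aut}(H^3(W_b,\mathbb{Z}),\langle\ ,\ \rangle)$, where $\langle\ ,\ \rangle$ is the cup product form. In a suitable symplectic basis this automorphism group is identified with $\mathrm{Sp}(4,\mathbb{Z})$, the local monodromies around $\lambda=0$ and $\lambda=1$ are the matrices $A$ and $T$, and $\Gamma$ is the subgroup of $\mathrm{Sp}(4,\mathbb{Z})$ generated by $A$ and $T$; this concrete description is the definition of $\Gamma$ used here. $\mathrm{Sp}(4,\mathbb{Z})$ is taken with respect to the standard form with matrix $\begin{pmatrix}0&I_2\\-I_2&0\end{pmatrix}$. *)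

(* Defs.v *)
From mathcomp Require Import all_boot all_order all_algebra.
From mathcomp Require Import boolp classical_sets.

Set Implicit Arguments.
Unset Strict Implicit.
Unset Printing Implicit Defensive.

Import GRing.Theory.
Local Open Scope classical_set_scope.
Local Open Scope ring_scope.

Definition mx4 (R : nzRingType) (s : seq (seq R)) : 'M[R]_4 :=
  \matrix_(i < 4, j < 4) nth 0 (nth [::] s i) j.

Definition GL4 (R : comUnitRingType) : set 'M[R]_4 := [set X | X \in unitmx].

Definition J4 : 'M[int]_4 := @block_mx _ 2 2 2 2 0 1%:M (- 1%:M) 0.

Definition Sp4Z : set 'M[int]_4 := [set X | X^T * J4 * X = J4].

Definition subgroup_Sp4Z (H : set 'M[int]_4) : Prop :=
  [/\ H `<=` Sp4Z, H 1,
      forall X Y, H X -> H Y -> H (X * Y)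
    & forall X, H X -> H X^-1].

Definition matA : 'M[int]_4 := mx4
  [:: [:: 11;  8; -5; 0];
      [::  5; -4; -3; 1];
      [:: 20; 15; -9; 0];
      [::  5; -5; -3; 1]].

Definition matT : 'M[int]_4 := mx4
  [:: [:: 1; 0; 0;  0];
      [:: 0; 1; 0; -1];
      [:: 0; 0; 1;  0];
      [:: 0; 0; 0;  1]].

(* The family over which [smallest] intersects is nonempty: it contains Sp4Z,
   by [Sp4Z_subgroup], [matA_Sp4Z] and [matT_Sp4Z] below. *)
Definition Gamma : set 'M[int]_4 := smallest subgroup_Sp4Z [set matA; matT].

Definition matP : 'M[rat]_4 := mx4
  [:: [::  5; -3; 0; 0];
      [::  0;  0; 1; 0];
      [:: 10; -5; 0; 0];
      [::  0;  0; 0; 1]].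

(* Elements of GL(4,Z) are compared with P^-1 X P inside 'M[rat]_4. *)
Definition Gamma' : set 'M[int]_4 :=
  [set Y | GL4 Y /\
     exists2 X, Gamma X &
       map_mx intr Y = matP^-1 * map_mx intr X * matP :> 'M[rat]_4].

Definition rho (X : 'M[int]_4) : 'M['Z_5]_4 := map_mx intr X.

Definition Gamma_tilde : set 'M['Z_5]_4 := rho @` Gamma'.

Definition Gamma_hat : set 'M['Z_5]_4 :=
  [set M | GL4 M /\ exists n a b c : 'Z_5,
     M = mx4 [:: [:: 1; n; 3 * n ^+ 2 + 2 * n; a];
                 [:: 0; 1; n; b];
                 [:: 0; 0; 1; c];
                 [:: 0; 0; 0; 1]]].

Lemma rho_GL4 (X : 'M[int]_4) : GL4 X -> GL4 (rho X).
Proof. exact: rmorph_unit (map_mx (intr : int -> 'Z_5)) X. Qed.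

Lemma J4_sq : J4 * J4 = -1.
Proof.
rewrite /J4 -[_ * _]/(_ *m _) (@mulmx_block _ 2 2 2 2 2 2).
rewrite !mul0mx !mulmx0 mulmxN mulNmx !mulmx1 !addr0 !add0r.
by rewrite -[RHS]/(- (1%:M : 'M_(2 + 2))) scalar_mx_block opp_block_mx oppr0.
Qed.

Lemma Sp4Z_unit (X : 'M[int]_4) : Sp4Z X -> X \is a GRing.unit.
Proof.
move=> /= XJ; have: (- (J4 * X^T * J4)) *m X = 1.
  by rewrite -[_ *m X]/(_ * X) mulNr -!mulrA [X^T * _]mulrA XJ J4_sq opprK.
by case/mulmx1_unit.
Qed.

Lemma Sp4Z_subgroup : subgroup_Sp4Z Sp4Z.
Proof.
rewrite /Sp4Z; split=> //= [|X Y XJ YJ|X XJ].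
- by have -> : (1 : 'M[int]_4)^T = 1 := trmx1 _ _; rewrite mul1r mulr1.
- have -> : (X * Y)^T = Y^T * X^T := trmx_mul _ _.
  by rewrite -[RHS]YJ -[in RHS]XJ !mulrA.
- have uX := Sp4Z_unit XJ.
  have uXT : X^T \is a GRing.unit by rewrite -unitmx_tr in uX.
  have -> : (X^-1)^T = (X^T)^-1 := trmx_inv X.
  apply: (mulrI uXT); apply: (mulIr uX).
  by rewrite !mulrA mulrV // mul1r XJ mulrVK.
Qed.

Lemma J4E : J4 = mx4
  [:: [:: 0; 0; 1; 0]; [:: 0; 0; 0; 1]; [:: -1; 0; 0; 0]; [:: 0; -1; 0; 0]].
Proof.
apply/matrixP => -[[|[|[|[|//]]]] ?] -[[|[|[|[|//]]]] ?]; rewrite !mxE;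
  by do 2 (rewrite /split; case: ltnP => //= ?; rewrite ?mxE).
Qed.

Lemma matA_Sp4Z : Sp4Z matA.
Proof.
apply/matrixP => i j; rewrite J4E !mxE !big_ord_recl !big_ord0 !mxE.
rewrite !big_ord_recl !big_ord0 !mxE.
by case: i => -[|[|[|[|//]]]] ?; case: j => -[|[|[|[|//]]]] ?; vm_compute.
Qed.

Lemma matT_Sp4Z : Sp4Z matT.
Proof.
apply/matrixP => i j; rewrite J4E !mxE !big_ord_recl !big_ord0 !mxE.
rewrite !big_ord_recl !big_ord0 !mxE.
by case: i => -[|[|[|[|//]]]] ?; case: j => -[|[|[|[|//]]]] ?; vm_compute.
Qed.

Lemma Gamma_sub_Sp4Z : Gamma `<=` Sp4Z.
Proof.
apply: smallest_sub; first exact: Sp4Z_subgroup.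
by move=> _ [->|->]; [exact: matA_Sp4Z | exact: matT_Sp4Z].
Qed.

Lemma matP_GL4 : GL4 matP.
Proof.
have: matP *m mx4 [:: [:: -1; 0; 3 / 5; 0]; [:: -2; 0; 1; 0]; [:: 0; 1; 0; 0]; [:: 0; 0; 0; 1]] = 1.
  apply/matrixP => i j; rewrite !mxE !big_ord_recl !big_ord0 !mxE.
  by case: i => -[|[|[|[|//]]]] ?; case: j => -[|[|[|[|//]]]] ?; apply/eqP; vm_compute.
by case/mulmx1_unit.
Qed.

(* Main.v *)
Require Import Defs.
From mathcomp Require Import all_boot all_order all_algebra.
From mathcomp Require Import boolp classical_sets.
From mathcomp Require Import ring.

(** Write an element of the target group as a block matrix (B_n v; 0 1), where
    B_n is the unipotent 3 x 3 matrix with first row (1, n, 3n^2+2n) and v is a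
    column in (Z/5)^3.  Modulo 5 the polynomial f(n) = 3n^2+2n satisfies
    f(m+n) = f(m) + mn + f(n), so n |-> B_n is a homomorphism, and the target is
    the semidirect product of Z/5 with the translation group (Z/5)^3
    ([hatM_mul]).

    Conjugation by P makes both generators integral, and their reductions are
    (B_{-1} e3; 0 1) for A and the translation by -e3 for T.  As the target is
    a group containing both, it contains the whole reduced monodromy group
    ([Gamma_integral_conj]).

    Conversely, conjugating the translation by -e3 with A and with its inverse
    gives the translations by -B_{-1} e3 = (-1, 1, -1) and by
    -B_1 e3 = (0, -1, -1), since f(-1) = 1 and f(1) = 0.  Together with e3 these
    span (Z/5)^3, so every translation is attained ([Gamma_tilde_translation]).
    The powers of A reach every value of n, and two elements with the same n
    differ by a translation. *)

Set Implicit Arguments.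
Unset Strict Implicit.
Unset Printing Implicit Defensive.

Import GRing.Theory.
Local Open Scope classical_set_scope.
Local Open Scope ring_scope.

(** * The group law of the target *)

Definition hatM (n a b c : 'Z_5) : 'M['Z_5]_4 :=
  mx4 [:: [:: 1; n; 3 * n ^+ 2 + 2 * n; a];
          [:: 0; 1; n; b];
          [:: 0; 0; 1; c];
          [:: 0; 0; 0; 1]].

(** The cross term of 3(m+n)^2 is 6mn, which equals mn modulo 5. *)
Lemma corner_add (m n : 'Z_5) :
  3 * (m + n) ^+ 2 + 2 * (m + n) =
  (3 * m ^+ 2 + 2 * m) + m * n + (3 * n ^+ 2 + 2 * n).
Proof.
have h5 : 5 = 0 :> 'Z_5 by apply/eqP.
have -> : 3 * (m + n) ^+ 2 + 2 * (m + n) =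
  (3 * m ^+ 2 + 2 * m) + m * n + (3 * n ^+ 2 + 2 * n) + 5 * (m * n) by ring.
by rewrite h5 mul0r addr0.
Qed.

Lemma hatM_mul n a b c n' a' b' c' :
  hatM n a b c * hatM n' a' b' c' =
  hatM (n + n') (a' + n * b' + (3 * n ^+ 2 + 2 * n) * c' + a)
       (b' + n * c' + b) (c' + c).
Proof.
apply/matrixP => i j; rewrite !mxE !big_ord_recl !big_ord0 !mxE.
case: i => -[|[|[|[|//]]]] ?; case: j => -[|[|[|[|//]]]] ?;
  rewrite /= ?corner_add; ring.
Qed.

Lemma hatM_1 : hatM 0 0 0 0 = 1.
Proof.
by apply/matrixP => i j; rewrite !mxE;
  case: i => -[|[|[|[|//]]]] ?; case: j => -[|[|[|[|//]]]] ?; apply/eqP.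
Qed.

Lemma mulmx1_inv (M N : 'M['Z_5]_4) : M * N = 1 -> M^-1 = N.
Proof.
move=> MN; have [uM _] := mulmx1_unit MN.
by rewrite -[N](mulKr uM) MN mulr1.
Qed.

Lemma hatM_inv n a b c : exists a' b' c', (hatM n a b c)^-1 = hatM (- n) a' b' c'.
Proof.
pose c' := - c; pose b' := - b - n * c'.
pose a' := - a - n * b' - (3 * n ^+ 2 + 2 * n) * c'.
exists a', b', c'.
have MN : hatM n a b c * hatM (- n) a' b' c' = 1.
  by rewrite hatM_mul -hatM_1 /a' /b' /c'; congr hatM; ring.
exact: mulmx1_inv MN.
Qed.

Lemma mulrn_val (x k : 'Z_5) : x *+ val k = x * k.
Proof. by rewrite -[LHS]mulr_natr; congr (_ * _); exact: natr_Zp. Qed.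

Lemma translation_expn a b c k :
  hatM 0 a b c ^+ k = hatM 0 (a *+ k) (b *+ k) (c *+ k).
Proof.
elim: k => [|k IHk]; first by rewrite expr0 !mulr0n hatM_1.
by rewrite exprS IHk hatM_mul !mulrS; congr hatM; ring.
Qed.

Lemma hatM_expn n a b c k :
  exists a' b' c', hatM n a b c ^+ k = hatM (n *+ k) a' b' c'.
Proof.
elim: k => [|k [a' [b' [c' IHk]]]].
  by exists 0, 0, 0; rewrite expr0 mulr0n hatM_1.
rewrite exprS IHk hatM_mul (mulrS n); do 3 eexists; reflexivity.
Qed.

(** * Integrality after conjugation by P *)

Lemma Gamma_subgroup : subgroup_Sp4Z Gamma.
Proof.
split=> [|H [[_ H1 _ _] _] //|X Y GX GY H HS|X GX H HS].
- exact: Gamma_sub_Sp4Z.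
- by case: (HS) => -[_ _ HM _] _; apply: HM; [apply: GX | apply: GY].
- by case: (HS) => -[_ _ _ HV] _; apply: HV; apply: GX.
Qed.

Lemma Gamma_A : Gamma matA.
Proof. by apply: sub_gen_smallest; left. Qed.

Lemma Gamma_T : Gamma matT.
Proof. by apply: sub_gen_smallest; right. Qed.

(** Stated without the inverse of P, so that it can be checked entrywise. *)
Definition integral_conj (X Y : 'M[int]_4) : Prop :=
  matP * map_mx intr Y = map_mx intr X * matP.

Lemma integral_conjE X Y :
  integral_conj X Y <->
  map_mx intr Y = matP^-1 * map_mx intr X * matP :> 'M[rat]_4.
Proof.
have uP : matP \is a GRing.unit := matP_GL4.
rewrite /integral_conj -mulrA; split=> [<-|->]; first by rewrite mulKr.
by rewrite mulVKr.
Qed.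

(** Reduction modulo 5 is only defined on the integral matrix, so the integral
    conjugate found for X has to be the given one. *)
Lemma integral_conj_inj X Y Y' :
  integral_conj X Y -> integral_conj X Y' -> Y = Y'.
Proof.
move=> /integral_conjE XY /integral_conjE; rewrite -XY.
move/matrixP => YY'; apply/matrixP => i j.
by have := YY' i j; rewrite !mxE => /intr_inj.
Qed.

Lemma integral_conj1 : integral_conj 1 1.
Proof. by rewrite /integral_conj !rmorph1 mul1r mulr1. Qed.

Lemma integral_conjM X X' Y Y' :
  integral_conj X Y -> integral_conj X' Y' -> integral_conj (X * X') (Y * Y').
Proof.
rewrite /integral_conj !rmorphM /= => XY XY'.
by rewrite mulrA XY -[LHS]mulrA XY' mulrA.
Qed.

(** Conjugate matrices have the same determinant. *)
Lemma integral_conj_unit X Y :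
  integral_conj X Y -> X \is a GRing.unit -> Y \is a GRing.unit.
Proof.
move=> XY; have uP : \det matP \is a GRing.unit by rewrite -unitmxE matP_GL4.
rewrite -[X \is a _]/(X \in unitmx) -[Y \is a _]/(Y \in unitmx) !unitmxE.
suff -> : \det Y = \det X by [].
apply: (@intr_inj rat); apply: (mulrI uP).
by rewrite -!det_map_mx -det_mulmx [matP *m _]XY [RHS]mulrC -det_mulmx.
Qed.

Lemma integral_conjV X Y :
  X \is a GRing.unit -> integral_conj X Y -> integral_conj X^-1 Y^-1.
Proof.
move=> uX XY; have uY := integral_conj_unit XY uX.
have uX' : map_mx intr X \is a @GRing.unit 'M[rat]_4 by apply: rmorph_unit.
have uY' : map_mx intr Y \is a @GRing.unit 'M[rat]_4 by apply: rmorph_unit.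
rewrite /integral_conj !rmorphV //.
by apply: (mulrI uX'); rewrite mulVKr // mulrA -XY mulrK.
Qed.

Definition conjA : 'M[int]_4 := mx4
  [:: [::  1; -1;  1; 0];
      [::  0;  1; -1; 0];
      [:: -5;  0; -4; 1];
      [:: -5;  0; -5; 1]].

Definition conjT : 'M[int]_4 := mx4
  [:: [:: 1; 0; 0;  0];
      [:: 0; 1; 0;  0];
      [:: 0; 0; 1; -1];
      [:: 0; 0; 0;  1]].

Lemma integral_conj_A : integral_conj matA conjA.
Proof.
apply/matrixP => i j; rewrite !mxE !big_ord_recl !big_ord0 !mxE.
by case: i => -[|[|[|[|//]]]] ?; case: j => -[|[|[|[|//]]]] ?;
  apply/eqP; vm_compute.
Qed.

Lemma integral_conj_T : integral_conj matT conjT.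
Proof.
apply/matrixP => i j; rewrite !mxE !big_ord_recl !big_ord0 !mxE.
by case: i => -[|[|[|[|//]]]] ?; case: j => -[|[|[|[|//]]]] ?;
  apply/eqP; vm_compute.
Qed.

Lemma rho_conjA : rho conjA = hatM (-1) 0 0 1.
Proof.
apply/matrixP => i j; rewrite !mxE.
by case: i => -[|[|[|[|//]]]] ?; case: j => -[|[|[|[|//]]]] ?;
  apply/eqP; vm_compute.
Qed.

Lemma rho_conjT : rho conjT = hatM 0 0 0 (-1).
Proof.
apply/matrixP => i j; rewrite !mxE.
by case: i => -[|[|[|[|//]]]] ?; case: j => -[|[|[|[|//]]]] ?;
  apply/eqP; vm_compute.
Qed.

Lemma rhoM X Y : rho (X * Y) = rho X * rho Y.
Proof. exact: (rmorphM (map_mx (intr : int -> 'Z_5))). Qed.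

Lemma rhoV Y : Y \is a GRing.unit -> rho Y^-1 = (rho Y)^-1.
Proof. exact: (rmorphV (map_mx (intr : int -> 'Z_5))). Qed.

(** Integrality of the conjugate and the shape of its reduction are proved
    together: the symplectic matrices with both properties form a subgroup, and
    it contains the two generators. *)
Lemma Gamma_integral_conj X : Gamma X ->
  exists2 Y, integral_conj X Y & exists n a b c, rho Y = hatM n a b c.
Proof.
pose K : set 'M[int]_4 := [set X | Sp4Z X /\
  exists2 Y, integral_conj X Y & exists n a b c, rho Y = hatM n a b c].
suff GK : Gamma `<=` K by case/GK.
apply: smallest_sub.
  have [_ S1 SM SV] := Sp4Z_subgroup; split.
  - by move=> Z [].
  - split=> //; exists 1; first exact: integral_conj1.
    by exists 0, 0, 0, 0; rewrite hatM_1 /rho rmorph1.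
  - move=> Z Z' [SZ [Y ZY [n [a [b [c YE]]]]]].
    move=> [SZ' [Y' ZY' [n' [a' [b' [c' YE']]]]]].
    split; first exact: SM.
    exists (Y * Y'); first exact: integral_conjM.
    rewrite rhoM YE YE' hatM_mul.
    by do 4 eexists; reflexivity.
  - move=> Z [SZ [Y ZY [n [a [b [c YE]]]]]]; have uZ := Sp4Z_unit SZ.
    split; first exact: SV.
    exists Y^-1; first exact: integral_conjV.
    rewrite rhoV ?YE; last exact: integral_conj_unit ZY uZ.
    by have [a' [b' [c' ->]]] := hatM_inv n a b c; do 4 eexists; reflexivity.
move=> _ [->|->].
  split; first exact: matA_Sp4Z.
  by exists conjA; [exact: integral_conj_A|rewrite rho_conjA; do 4 eexists; reflexivity].
split; first exact: matT_Sp4Z.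
by exists conjT; [exact: integral_conj_T|rewrite rho_conjT; do 4 eexists; reflexivity].
Qed.

(** * Generation of the target *)

Lemma Gamma_tildeP M :
  Gamma_tilde M <-> exists X Y, [/\ Gamma X, integral_conj X Y & rho Y = M].
Proof.
split=> [[Y [_ [X GX /integral_conjE XY]] <-]|[X [Y [GX XY <-]]]].
  by exists X, Y.
exists Y => //; split; last by exists X => //; apply/integral_conjE.
exact: integral_conj_unit XY (Sp4Z_unit (Gamma_sub_Sp4Z GX)).
Qed.

Lemma Gamma_tilde1 : Gamma_tilde 1.
Proof.
apply/Gamma_tildeP; exists 1, 1; have [_ G1 _ _] := Gamma_subgroup.
by split=> //; [exact: integral_conj1|rewrite /rho rmorph1].
Qed.

Lemma Gamma_tildeM M N : Gamma_tilde M -> Gamma_tilde N -> Gamma_tilde (M * N).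
Proof.
move=> /Gamma_tildeP[X [Y [GX XY <-]]] /Gamma_tildeP[X' [Y' [GX' XY' <-]]].
apply/Gamma_tildeP; exists (X * X'), (Y * Y'); have [_ _ GM _] := Gamma_subgroup.
by split; [exact: GM|exact: integral_conjM|rewrite rhoM].
Qed.

Lemma Gamma_tildeV M : Gamma_tilde M -> Gamma_tilde M^-1.
Proof.
move=> /Gamma_tildeP[X [Y [GX XY <-]]]; have uX := Sp4Z_unit (Gamma_sub_Sp4Z GX).
apply/Gamma_tildeP; exists X^-1, Y^-1; have [_ _ _ GV] := Gamma_subgroup.
split; [exact: GV|exact: integral_conjV|].
by rewrite rhoV //; exact: integral_conj_unit XY uX.
Qed.

Lemma Gamma_tildeX M k : Gamma_tilde M -> Gamma_tilde (M ^+ k).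
Proof.
move=> GM; elim: k => [|k IHk]; first exact: Gamma_tilde1.
by rewrite exprS; exact: Gamma_tildeM.
Qed.

Lemma Gamma_tilde_A : Gamma_tilde (hatM (-1) 0 0 1).
Proof.
apply/Gamma_tildeP; exists matA, conjA.
by split; [exact: Gamma_A|exact: integral_conj_A|exact: rho_conjA].
Qed.

Lemma Gamma_tilde_T : Gamma_tilde (hatM 0 0 0 (-1)).
Proof.
apply/Gamma_tildeP; exists matT, conjT.
by split; [exact: Gamma_T|exact: integral_conj_T|exact: rho_conjT].
Qed.

Lemma Gamma_tilde_scale a b c (k : 'Z_5) :
  Gamma_tilde (hatM 0 a b c) -> Gamma_tilde (hatM 0 (a * k) (b * k) (c * k)).
Proof.
move=> /(@Gamma_tildeX _ (val k)); rewrite translation_expn.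
by rewrite !mulrn_val.
Qed.

(** The vectors (-1, 1, -1), (0, -1, -1) and (0, 0, -1) are a basis of (Z/5)^3,
    and the translations by them are conjugates of T by A, by the inverse of A
    and by the identity. *)
Lemma Gamma_tilde_translation a b c : Gamma_tilde (hatM 0 a b c).
Proof.
have GA := Gamma_tilde_A; have GT := Gamma_tilde_T; have GA' := Gamma_tildeV GA.
have AV : (hatM (-1) 0 0 1)^-1 = hatM 1 0 (-1) (-1).
  have MN : hatM (-1) 0 0 1 * hatM 1 0 (-1) (-1) = 1.
    by rewrite hatM_mul -hatM_1; congr hatM; apply/eqP; vm_compute.
  exact: mulmx1_inv MN.
have G1 : Gamma_tilde (hatM 0 (-1) 1 (-1)).
  suff <- : hatM (-1) 0 0 1 * hatM 0 0 0 (-1) * (hatM (-1) 0 0 1)^-1 =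
            hatM 0 (-1) 1 (-1) by do !apply: Gamma_tildeM.
  by rewrite AV !hatM_mul; congr hatM; apply/eqP; vm_compute.
have G2 : Gamma_tilde (hatM 0 0 (-1) (-1)).
  suff <- : (hatM (-1) 0 0 1)^-1 * hatM 0 0 0 (-1) * hatM (-1) 0 0 1 =
            hatM 0 0 (-1) (-1) by do !apply: Gamma_tildeM.
  by rewrite AV !hatM_mul; congr hatM; apply/eqP; vm_compute.
(* The coordinates of (a, b, c) in the basis (-1, 1, -1), (0, -1, -1),
   (0, 0, -1). *)
have -> : hatM 0 a b c =
    hatM 0 (- 1 * - a) (1 * - a) (- 1 * - a) *
    hatM 0 (0 * (- a - b)) (- 1 * (- a - b)) (- 1 * (- a - b)) *
    hatM 0 (0 * (2 * a + b - c)) (0 * (2 * a + b - c)) (- 1 * (2 * a + b - c)).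
  by rewrite !hatM_mul; congr hatM; ring.
by do !apply: Gamma_tildeM; apply: Gamma_tilde_scale.
Qed.

Theorem mainTheorem1 : Gamma_tilde = Gamma_hat.
Proof.
apply/seteqP; split=> [M [Y [uY [X GX /integral_conjE XY]] <-]|M [_]].
  split; first exact: rho_GL4.
  have [Y' XY' hatY'] := Gamma_integral_conj GX.
  by rewrite (integral_conj_inj XY XY').
case=> n [a [b [c ->]]].
(* A reduces to an element with n = -1, so its power of exponent -n, read as a
   natural number, has the wanted n. *)
have [a' [b' [c' AkE]]] := hatM_expn (-1) 0 0 1 (val (- n)).
have nE : (-1 : 'Z_5) *+ val (- n) = n.
  by rewrite mulrn_val mulN1r opprK.
rewrite nE in AkE.
rewrite -[mx4 _]/(hatM n a b c).
have -> : hatM n a b c =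
    hatM 0 (a - a') (b - b') (c - c') * hatM (-1) 0 0 1 ^+ val (- n).
  by rewrite AkE hatM_mul; congr hatM; ring.
apply: Gamma_tildeM; first exact: Gamma_tilde_translation.
exact/Gamma_tildeX/Gamma_tilde_A.
Qed.
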